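(* Let $k\geq 2$. Let $\mathcal{SCU}_k(n)$ denote the number of self-conjugate $k$-marked strongly unimodal symbols of size $n$, and $SCU_k(q):=\sum_{n\ge 0}\mathcal{SCU}_k(n)q^n$. Then \[ SCU_k(q)=\sum_{n\geq0}(-1)^k\big(\omega_k(n)-\epsilon_k(n)\big)q^n . \]
   Context: A strongly unimodal sequence of size $n$ is a finite list of positive integers $a_1<\cdots<a_r>a_{r+1}>\cdots>a_s$ summing to $n$, with peak $a_r$. Its strongly unimodal symbol consists of the peak size $P=a_r$, a top row listing the parts right of the peak ($a_{r+1}>\cdots>a_s$), and a bottom row listing the parts left of the peak in decreasing order ($a_{r-1}>\cdots>a_1$); the size is $P$ plus the sum of all parts in both rows. A $k$-marked strongly unimodal symbol ($k\ge2$) is such a symbol in which every part in both rows carries a subscript from $\{1,\dots,k\}$, subject to: (1) in each row the parts are strictly decreasing and the subscripts are nonincreasing; (2) in the top row each of $1,\dots,k-1$ appears as a subscript of some part; (3) letting $M_j$ be the largest part with subscript $j$ in the top row ($1\le j\le k-1$), $M_0:=0$, and $M_k$ the peak size, all bottom-row parts with subscript $j\le k-1$ lie in $[M_{j-1}+1,M_j]$ and those with subscript $k$ lie in $[M_{k-1}+1,M_k-1]$. It is self-conjugate if its top and bottom rows are identical (same parts with the same subscripts). $\omega_k(n)$ counts the objects of total size $n$ consisting of: a partition into at least $k$ unmarked odd parts such that every odd part less than the largest part appears at least once; together with even parts taking exactly $k-1$ distinct values, these values carrying the $k-1$ different marks $1,\dots,k-1$ (i.e. values $2M_1<2M_2<\cdots<2M_{k-1}$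 with $2M_j$ marked $j$), each value allowed to repeat, every even part less than twice the number of odd parts, and the total number of even parts odd. $\epsilon_k(n)$ counts the same objects except that the total number of even parts is even. *)

(* Defs.v *)
From HB Require Import structures.
From mathcomp Require Import all_boot all_order all_algebra.
From mathcomp Require Import finmap.
From mathcomp Require Import boolp classical_sets functions cardinality.

Set Implicit Arguments.
Unset Strict Implicit.
Unset Printing Implicit Defensive.

Local Open Scope classical_set_scope.
Local Open Scope nat_scope.

(* Formal power series in q over R; [Fps c] is \sum_(n >= 0) c n * q^n. *)
Record fps (R : Type) := Fps { coef_fps : nat -> R }.

(* Number of elements of a finite set ([fset_set] of an infinite set is empty;
   all the sets counted below are finite, see the lemmas [finite_*]). *)
Definition number_of (T : choiceType) (A : set T) : nat := #|` fset_set A |.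

(* [a] is a_1 < ... < a_r > a_(r+1) > ... > a_s with positive entries; the peak
   is at 0-based position [r]. *)
Definition strongly_unimodal (a : seq nat) (r : nat) : bool :=
  [&& r < size a, all (ltn 0) a, sorted ltn (take r.+1 a)
    & sorted gtn (drop r a)].

(* A marked part is a pair (part, mark). *)
Definition mpart := (nat * nat)%type.
Definition part (x : mpart) : nat := x.1.
Definition mark (x : mpart) : nat := x.2.

Record msymbol := MSymbol {
  peak : nat;
  top_row : seq mpart;
  bottom_row : seq mpart
}.

Definition msymbol_rep (s : msymbol) := (peak s, top_row s, bottom_row s).
Definition msymbol_of (u : nat * seq mpart * seq mpart) :=
  MSymbol u.1.1 u.1.2 u.2.
Lemma msymbol_repK : cancel msymbol_rep msymbol_of.
Proof. by case. Qed.
HB.instance Definition _ := Equality.copy msymbol (can_type msymbol_repK).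
HB.instance Definition _ := Choice.copy msymbol (can_type msymbol_repK).

(* The sequence whose symbol, once the subscripts are forgotten, is [s]. *)
Definition sequence_of (s : msymbol) : seq nat :=
  rev (map part (bottom_row s)) ++ peak s :: map part (top_row s).

Definition msymbol_size (s : msymbol) : nat :=
  peak s + sumn (map part (top_row s)) + sumn (map part (bottom_row s)).

(* The bounds M_0, ..., M_k. *)
Definition Mbound (k : nat) (s : msymbol) (j : nat) : nat :=
  if j == 0 then 0 else if j == k then peak s
  else \max_(x <- top_row s | mark x == j) part x.

Definition marked_row (k : nat) (r : seq mpart) : bool :=
  [&& all (fun x => 1 <= mark x <= k) r,
      sorted gtn (map part r) & sorted geq (map mark r)].

Definition marked_symbol (k : nat) (s : msymbol) : Prop :=
  [/\ strongly_unimodal (sequence_of s) (size (bottom_row s)),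
      marked_row k (top_row s) /\ marked_row k (bottom_row s),
      (forall j, 1 <= j <= k.-1 -> j \in map mark (top_row s)),
      (forall x, x \in bottom_row s -> mark x <= k.-1 ->
         (Mbound k s (mark x).-1).+1 <= part x <= Mbound k s (mark x)) &
      (forall x, x \in bottom_row s -> mark x = k ->
         (Mbound k s k.-1).+1 <= part x <= (Mbound k s k).-1)].

Definition self_conjugate (s : msymbol) : Prop := top_row s = bottom_row s.

Definition SCU_set (k n : nat) : set msymbol :=
  [set s | [/\ marked_symbol k s, self_conjugate s & msymbol_size s = n]].

Definition scu (k n : nat) : nat := number_of (SCU_set k n).

Definition SCU (k : nat) : fps int := Fps (fun n => Posz (scu k n)).

(* [o] lists the odd parts, in weakly decreasing order. *)
Definition odd_parts_ok (k : nat) (o : seq nat) : Prop :=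
  [/\ sorted geq o, all odd o, k <= size o &
      forall i, odd i -> i < \max_(x <- o) x -> i \in o].

(* [e] lists the even parts with their marks, in weakly decreasing order of the
   parts, and [m] is the number of odd parts. *)
Definition even_parts_ok (k m : nat) (e : seq mpart) : Prop :=
  [/\ sorted geq (map part e), all (fun x => part x < m.*2) e &
      exists M : nat -> nat,
      [/\ (forall j, 1 <= j <= k.-1 -> 0 < M j),
          (forall i j, 1 <= i -> i < j -> j <= k.-1 -> M i < M j),
          (forall x, x \in e ->
             1 <= mark x <= k.-1 /\ part x = (M (mark x)).*2) &
          (forall j, 1 <= j <= k.-1 -> ((M j).*2, j) \in e)]].

Definition marked_partition (k n : nat) : set (seq nat * seq mpart) :=
  [set u | [/\ odd_parts_ok k u.1, even_parts_ok k (size u.1) u.2 &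
               sumn u.1 + sumn (map part u.2) = n]].

Definition omega (k n : nat) : nat :=
  number_of (marked_partition k n `&` [set u | odd (size u.2)]).

Definition epsilon (k n : nat) : nat :=
  number_of (marked_partition k n `&` [set u | ~~ odd (size u.2)]).

Lemma finite_seqs (T : eqType) (A : set T) (n : nat) : finite_set A ->
  finite_set [set s : seq T | size s <= n /\ forall x, x \in s -> A x].
Proof.
move=> fA; elim: n => [|n IHn].
  apply: (@sub_finite_set _ _ [set [::]]) => //.
  by move=> s /= [+ _]; case: s.
apply: (@sub_finite_set _ _ ([set [::]] `|` (fun p => p.1 :: p.2) @`
   (A `*` [set s : seq T | size s <= n /\ forall x, x \in s -> A x]))).
  move=> [|x s] /= [sz sA]; [by left | right].
  exists (x, s) => //; split=> /=; first by apply: sA; rewrite mem_head.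
  by split=> // y ys; apply: sA; rewrite in_cons ys orbT.
by rewrite finite_setU; split=> //; apply/finite_image/finite_setX.
Qed.

Lemma size_le_sumn (s : seq nat) : all (ltn 0) s -> size s <= sumn s.
Proof. by elim: s => //= x s IH /andP[x0 /IH]; rewrite -add1n; apply: leq_add. Qed.

Lemma mem_le_sumn (s : seq nat) x : x \in s -> x <= sumn s.
Proof.
elim: s => //= y s IH; rewrite in_cons => /orP[/eqP->|/IH h].
  exact: leq_addr.
exact: leq_trans h (leq_addl _ _).
Qed.

Definition bounded_rows (k n : nat) : set (seq mpart) :=
  [set s | size s <= n /\ forall x, x \in s -> (`I_n.+1 `*` `I_k.+1) x].

Lemma finite_bounded_rows k n : finite_set (bounded_rows k n).
Proof. by apply/finite_seqs/finite_setX; exact: finite_II. Qed.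

Lemma bounded_rowP k n (r : seq mpart) : all (ltn 0) (map part r) ->
  (forall x, x \in r -> mark x <= k) -> sumn (map part r) <= n ->
  bounded_rows k n r.
Proof.
move=> r0 rk rn; split.
  by rewrite -(size_map part); apply: leq_trans (size_le_sumn r0) rn.
move=> x xr; split=> /=; rewrite ltnS; last exact: rk.
by apply: leq_trans rn; apply: mem_le_sumn; apply: map_f.
Qed.

Lemma finite_SCU_set k n : finite_set (SCU_set k n).
Proof.
apply: (@sub_finite_set _ _ (msymbol_of @`
   (`I_n.+1 `*` bounded_rows k n `*` bounded_rows k n))); last first.
  apply/finite_image/finite_setX; last exact: finite_bounded_rows.
  by apply: finite_setX; [exact: finite_II | exact: finite_bounded_rows].
move=> s [[/and4P[_ pos _ _] [/and3P[tk _ _] /and3P[bk _ _]] _ _ _] _ szn].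
move: pos; rewrite all_cat all_rev /= => /and3P[b0 _ t0].
exists (msymbol_rep s); last exact: msymbol_repK.
rewrite -szn /msymbol_size; split; first split.
- by rewrite /= ltnS -addnA leq_addr.
- apply: bounded_rowP => // [x /(allP tk)/andP[]//|].
  by rewrite -addnA addnCA leq_addr.
- by apply: bounded_rowP => // [x /(allP bk)/andP[]//|]; rewrite leq_addl.
Qed.

Lemma finite_marked_partition k n : finite_set (marked_partition k n).
Proof.
apply: (@sub_finite_set _ _
  ([set s : seq nat | size s <= n /\ forall x, x \in s -> `I_n.+1 x]
    `*` bounded_rows k n)); last first.
  apply: finite_setX; last exact: finite_bounded_rows.
  by apply: finite_seqs; exact: finite_II.
move=> [o e] [/= [_ oo _ _] [_ _ [M [M0 _ eM _]]] szn].
rewrite -szn; split=> /=; first split.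
- apply: leq_trans (leq_addr _ _); apply: size_le_sumn.
  by apply/allP => x /(allP oo); case: x.
- move=> x xo; rewrite ltnS.
  exact: leq_trans (mem_le_sumn xo) (leq_addr _ _).
- apply: bounded_rowP; last exact: leq_addl.
    apply/allP => _ /mapP[x /eM[xk ->] ->] /=.
    by rewrite double_gt0; apply: M0.
  by move=> x /eM[/andP[_ xk] _]; apply: leq_trans xk (leq_pred k).
Qed.

(* Main.v *)
(** For a set or multiset of integers in [1, m-1], consider triples (m, D, h)
    where D is a set, h is a multiset with exactly k - 1 distinct values, and
    the weight is m + 2 (sum D + sum h). Conjugating the partition of the
    halved odd parts turns m odd parts without gaps into m and a set D: the
    i-th odd part (from 0) is 1 + 2 #{d in D | d > i}. The even parts are the
    doubles of h, and their marks are forced to be ranks, so omega and epsilon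
    count triples with #h odd and even respectively.

    Take the least x in h that also lies in D or is repeated in h, and move one
    copy of x from D to h if x is in D, from h to D otherwise. This preserves
    the weight, keeps x the least such value, and flips the parity of #h. The
    triples left over have h without repetition and disjoint from D, so
    #h = k - 1, which gives the sign (-1)^k. They are the self-conjugate
    symbols: the rows consist of D and h together, h being {M_1 < ... <
    M_(k-1)}, and p is marked 1 + #{a in h | a < p}. *)

From mathcomp Require Import finmap.
From mathcomp Require Import boolp classical_sets functions cardinality.
Require Import Defs.
From mathcomp Require Import all_boot all_order all_algebra.
From mathcomp Require Import zify.

Set Implicit Arguments.
Unset Strict Implicit.
Unset Printing Implicit Defensive.

Local Open Scope nat_scope.

(** * Decreasing lists of naturals as canonical forms of sets and multisets *)

Lemma geq_total : total geq.
Proof. by move=> x y; rewrite /geq /=; exact: leq_total. Qed.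

Lemma geq_trans : transitive geq.
Proof. by move=> x y z /= xy yz; exact: leq_trans yz xy. Qed.

Lemma geq_anti : antisymmetric geq.
Proof. by move=> x y /= h; apply/anti_leq; rewrite andbC. Qed.

Lemma gtn_trans : transitive gtn.
Proof. by move=> x y z /= xy yz; exact: ltn_trans yz xy. Qed.

Lemma eq_sorted_geq s1 s2 :
  sorted geq s1 -> sorted geq s2 -> perm_eq s1 s2 -> s1 = s2.
Proof. exact: (sorted_eq geq_trans geq_anti). Qed.

Lemma eq_sorted_gtn s1 s2 :
  sorted gtn s1 -> sorted gtn s2 -> s1 =i s2 -> s1 = s2.
Proof. exact: (irr_sorted_eq gtn_trans ltnn). Qed.

(** * Counting along bijections and by splitting *)

Section Counting.
Local Open Scope classical_set_scope.
Variables S T : choiceType.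

Lemma image_of_bij (A : set S) (B : set T) (f : S -> T) (g : T -> S) :
  (forall x, A x -> B (f x)) -> (forall y, B y -> A (g y)) ->
  (forall y, B y -> f (g y) = y) -> f @` A = B.
Proof.
move=> fB gA fK; apply/seteqP; split=> [_ [x Ax <-]|y By]; first exact: fB.
by exists (g y); [exact: gA | exact: fK].
Qed.

Lemma finite_set_bij (A : set S) (B : set T) (f : S -> T) (g : T -> S) :
  finite_set A -> (forall x, A x -> B (f x)) -> (forall y, B y -> A (g y)) ->
  (forall y, B y -> f (g y) = y) -> finite_set B.
Proof. by move=> fA fB gA /(image_of_bij fB gA) <-; exact: finite_image. Qed.

Lemma number_of_bij (A : set S) (B : set T) (f : S -> T) (g : T -> S) :
  finite_set A -> (forall x, A x -> B (f x)) -> (forall y, B y -> A (g y)) ->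
  (forall x, A x -> g (f x) = x) -> (forall y, B y -> f (g y) = y) ->
  number_of A = number_of B.
Proof.
move=> fA fB gA gK /(image_of_bij fB gA) <-.
rewrite /number_of fset_set_image// card_in_imfset// => x y.
rewrite !in_fset_set// => /set_mem Ax /set_mem Ay exy.
by rewrite -(gK _ Ax) -(gK _ Ay) exy.
Qed.

Lemma number_of_split (A F : set S) : finite_set A ->
  number_of A = number_of (A `&` F) + number_of (A `\` F).
Proof.
move=> fA; rewrite /number_of.
have fI : finite_set (A `&` F) by apply: finite_setIl.
have fD : finite_set (A `\` F) by exact: finite_setD.
rewrite -[in LHS](setUIDK A F) fset_setU// cardfsU -fset_setI//.
have -> : A `&` F `&` (A `\` F) = classical_sets.set0.
  by apply/seteqP; split=> // x [[_ Fx] [_]].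
by rewrite fset_set0 cardfs0 subn0.
Qed.

End Counting.

(** * Cancellation by a parity-reversing involution *)

Section Involution.
Local Open Scope classical_set_scope.
Variable S : choiceType.

(** Outside [F] the map [t] exchanges the two parity classes bijectively, while all of [A] inside
    [F] has parity [b]; hence class [b] has exactly the elements of [F] in excess. *)
Lemma number_of_involution (A F : set S) (w : S -> nat) (t : S -> S) (b : bool) :
  finite_set A ->
  (forall x, A x -> F x -> odd (w x) = b) ->
  (forall x, A x -> ~ F x -> [/\ A (t x), ~ F (t x), t (t x) = x &
     odd (w (t x)) = ~~ odd (w x)]) ->
  number_of (A `&` [set x | odd (w x) = b]) =
  number_of (A `&` F) + number_of (A `&` [set x | odd (w x) = ~~ b]).
Proof.
move=> fA wF tA.
rewrite (@number_of_split _ (A `&` _) F); last exact: finite_setIl.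
congr (_ + _).
  congr number_of; apply/seteqP; split=> x [].
    by move=> [].
  by move=> Ax Fx; split=> //; split=> //=; exact: wF.
apply: (@number_of_bij _ _ _ _ t t).
- by apply: finite_setD; exact: finite_setIl.
- move=> x [[Ax /= wx] nFx]; have [Atx nFtx _ wtx] := tA x Ax nFx.
  by split=> //=; rewrite wtx wx.
- move=> x [Ax /= wx].
  have nFx : ~ F x by move=> /(wF _ Ax); rewrite wx; case: b {wF wx}.
  have [Atx nFtx _ wtx] := tA x Ax nFx.
  by split=> //; split=> //=; rewrite wtx wx negbK.
- by move=> x [[Ax _] nFx]; have [] := tA x Ax nFx.
- move=> x [Ax /= wx].
  have nFx : ~ F x by move=> /(wF _ Ax); rewrite wx; case: b {wF wx}.
  by have [] := tA x Ax nFx.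
Qed.

End Involution.

(** * Triples and the involution on them *)

Definition between (m : nat) : pred nat := fun x => 0 < x < m.

(* (m, D, h); D and the multiset h are represented by decreasing sequences. *)
Definition triple := (nat * seq nat * seq nat)%type.

Definition is_triple (k n : nat) (u : triple) : bool :=
  let: (m, D, h) := u in
  [&& sorted gtn D && sorted geq h, all (between m) D && all (between m) h,
      size (undup h) == k.-1 & m + (sumn D + sumn h).*2 == n].

Definition movable (D h : seq nat) (x : nat) : bool :=
  (x \in h) && ((x \in D) || (1 < count_mem x h)).

Definition is_fixed (u : triple) : bool :=
  let: (m, D, h) := u in ~~ has (movable D h) h.

(** Position i of [iota 0 m] holds i, so [find] returns the least movable value itself. If there is
    none it returns [m]; on triples this happens only at fixed ones, where [toggle] is never
    applied. *)
Definition toggle (u : triple) : triple :=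
  let: (m, D, h) := u in
  let x := find (movable D h) (iota 0 m) in
  if x \in D then (m, rem x D, sort geq (x :: h))
  else (m, sort geq (x :: D), rem x h).

(** Only the status of x could change: it leaves [D], but now occurs at least twice in [h], so it
    stays movable. *)
Lemma movable_insert D h x : uniq D -> x \in D -> movable D h x ->
  movable (rem x D) (sort geq (x :: h)) =1 movable D h.
Proof.
move=> uD xD mx y; have /andP[xh _] := mx.
rewrite /movable mem_sort in_cons count_sort /= mem_rem_uniq// inE.
have [->|//] := eqVneq y x.
by rewrite /= xh xD add1n ltnS -has_count has_pred1 xh.
Qed.

(** Since x is not in [D], it is repeated in [h]; after the move one copy remains in [h] and x lies
    in [D], so it stays movable. *)
Lemma movable_remove D h x : x \notin D -> movable D h x ->
  movable (sort geq (x :: D)) (rem x h) =1 movable D h.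
Proof.
move=> xD /andP[xh]; rewrite (negPf xD) /= => cx y.
have /permP ch := perm_to_rem xh.
have hy : (y \in rem x h) = (y \in h).
  rewrite -!has_pred1 !has_count ch /=.
  move: cx; rewrite ch /= eqxx; have [<-|] := eqVneq x y; lia.
rewrite /movable hy mem_sort in_cons ch /=.
have [->|] := eqVneq y x => //=. by move: cx; rewrite (negPf xD) ch /= eqxx => ->.
Qed.

Lemma find_movable m D h (x := find (movable D h) (iota 0 m)) :
  all (between m) h -> has (movable D h) h -> movable D h x /\ between m x.
Proof.
move=> hm /hasP[y yh my].
have ym : y < m by move/allP: hm => /(_ _ yh) /andP[].
have hy : has (movable D h) (iota 0 m).
  by apply/hasP; exists y => //; rewrite mem_iota.
have xm : x < m by have := hy; rewrite has_find size_iota.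
have := nth_find 0 hy; rewrite nth_iota// add0n => mx; split=> //.
by case/andP: mx => /(allP hm).
Qed.

Lemma size_undup_mem (s1 s2 : seq nat) :
  s1 =i s2 -> size (undup s1) = size (undup s2).
Proof. by move=> e; exact/perm_size/perm_undup. Qed.

Lemma sorted_geq_rem (x : nat) s : sorted geq s -> sorted geq (rem x s).
Proof. by apply: subseq_sorted; [exact: geq_trans | exact: rem_subseq]. Qed.

Lemma sort_cons_rem (x : nat) s :
  sorted geq s -> x \in s -> sort geq (x :: rem x s) = s.
Proof.
move=> ss xs; apply: eq_sorted_geq => //.
  by apply: sort_sorted; exact: geq_total.
by rewrite perm_sort perm_sym; exact: perm_to_rem.
Qed.

Lemma rem_sort_cons (x : nat) s : sorted geq s -> rem x (sort geq (x :: s)) = s.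
Proof.
move=> ss; apply: eq_sorted_geq => //.
  by apply/sorted_geq_rem/sort_sorted; exact: geq_total.
rewrite -(perm_cons x) perm_sym -(perm_sort geq); apply: perm_to_rem.
by rewrite mem_sort mem_head.
Qed.

Lemma sumn_sort s : sumn (sort geq s) = sumn s.
Proof. by apply: perm_sumn; rewrite perm_sort. Qed.

Lemma sumn_rem (x : nat) s : x \in s -> sumn s = x + sumn (rem x s).
Proof. by move/perm_to_rem/perm_sumn. Qed.

Lemma sumn_sort_cons x s : sumn (sort geq (x :: s)) = x + sumn s.
Proof. by rewrite sumn_sort. Qed.

Lemma toggle_triple k n u : is_triple k n u -> ~~ is_fixed u ->
  [/\ is_triple k n (toggle u), ~~ is_fixed (toggle u), toggle (toggle u) = u &
      odd (size (toggle u).2) = ~~ odd (size u.2)].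
Proof.
case: u => [[m D] h] /= /and4P[/andP[sD sh] /andP[Dm hm] /eqP uk /eqP sz].
rewrite negbK => nf; have [] := find_movable hm nf.
set x := find _ _ => mx xm.
have /andP[uD gD] : uniq D && sorted geq D by rewrite -gtn_sorted_uniq_geq.
have /andP[xh _] := mx.
have xmE : all (between m) [:: x] by rewrite /= xm.
case: ifPn => xD.
  have mE := movable_insert uD xD mx.
  (* The movable values are unchanged, so the second toggle selects the same x, takes the other
     branch and undoes the move. *)
  rewrite /= (eq_find mE) -/x mem_rem_uniqF//= sort_cons_rem// rem_sort_cons//.
  rewrite negbK (eq_has mE) size_sort; split=> //.
    have sz' : sumn (rem x D) + sumn (sort geq (x :: h)) = sumn D + sumn h.
      by rewrite (sumn_rem xD) sumn_sort_cons; lia.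
    rewrite sz' sz eqxx (size_undup_mem (s2 := h)); last first.
      by move=> y; rewrite mem_sort in_cons; case: eqP => // ->.
    rewrite uk eqxx !andbT all_sort /= xm hm sort_sorted ?andbT; last exact: geq_total.
    rewrite gtn_sorted_uniq_geq rem_uniq// sorted_geq_rem//=.
    by apply/allP => y /mem_rem/(allP Dm).
  by apply/hasP; exists x => //; rewrite mem_sort mem_head.
have mE := movable_remove xD mx.
(* A copy of x survives in [h]: the set of distinct values is unchanged and x still witnesses that
   the triple is not fixed. *)
have xr : x \in rem x h.
  have : movable (sort geq (x :: D)) (rem x h) x by rewrite mE.
  by case/andP.
rewrite /= (eq_find mE) -/x mem_sort mem_head rem_sort_cons// sort_cons_rem//.
rewrite negbK (eq_has mE) size_rem//; split=> //.
- have sz' : sumn (sort geq (x :: D)) + sumn (rem x h) = sumn D + sumn h.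
    by rewrite (sumn_rem xh) sumn_sort_cons; lia.
  rewrite sz' sz eqxx (size_undup_mem (s2 := h)); last first.
    move=> y; apply/idP/idP => [/mem_rem//|yh].
    have [->//|yx] := eqVneq y x.
    by move: (perm_mem (perm_to_rem xh) y); rewrite yh in_cons (negPf yx).
  rewrite uk eqxx !andbT all_sort /= xm Dm sorted_geq_rem// gtn_sorted_uniq_geq.
  rewrite sort_uniq /= xD uD sort_sorted; last exact: geq_total.
  by apply/allP => y /mem_rem/(allP hm).
- by apply/hasP; exists x.
- have : 0 < size h by case: (h) xh.
  by case: (size h) => //= p; rewrite negbK.
Qed.

(** * Odd parts without gaps and sets of descents *)

Definition odd_of (m : nat) (D : seq nat) : seq nat :=
  mkseq (fun i => (count (ltn i) D).*2.+1) m.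

(** Inverse of [odd_of]: between positions i - 1 and i the count of larger elements of D drops
    exactly when i is in D. The reversal makes the list decreasing. *)
Definition descents (o : seq nat) : seq nat :=
  [seq i <- rev (iota 1 (size o).-1) | nth 0 o i.-1 != nth 0 o i].

Definition even_of (h : seq nat) : seq mpart :=
  [seq (p.*2, count (fun v => v <= p) (undup h)) | p <- h].

Definition halves (e : seq mpart) : seq nat := [seq (part x)./2 | x <- e].

Lemma sorted_gtn_rev_iota a b : sorted gtn (rev (iota a b)).
Proof. by rewrite rev_sorted; exact: iota_ltn_sorted. Qed.

Lemma sorted_gtn_filter (p : pred nat) s :
  sorted gtn s -> sorted gtn (filter p s).
Proof. exact/sorted_filter/gtn_trans. Qed.

Lemma sorted_gtn_uniq s : sorted gtn s -> uniq s.
Proof. by rewrite gtn_sorted_uniq_geq => /andP[]. Qed.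

Lemma size_between m s : uniq s -> all (between m) s -> size s <= m.-1.
Proof.
move=> us sm; rewrite -[leqRHS](size_iota 1); apply: uniq_leq_size => // x.
by move=> /(allP sm); rewrite mem_iota /between; lia.
Qed.

Lemma count_gtn_nth s i : sorted gtn s -> i < size s ->
  count (ltn (nth 0 s i)) s = i.
Proof.
elim: s i => //= x s IH [|i] /= px.
  move=> _; rewrite ltnn; apply/eqP; rewrite add0n -leqn0 leqNgt -has_count.
  apply/hasPn => y ys; rewrite -leqNgt ltnW//.
  by move: px; rewrite path_sortedE; [move=> /andP[/allP/(_ _ ys)] | exact: gtn_trans].
rewrite ltnS => si; rewrite IH//; last exact: path_sorted px.
suff -> : nth 0 s i < x by [].
move: px; rewrite path_sortedE; last exact: gtn_trans.
by case/andP => /allP/(_ _ (mem_nth 0 si)).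
Qed.

Lemma odd_of_sorted m D : sorted geq (odd_of m D).
Proof.
apply: (homo_sorted (e := ltn)); last exact: iota_ltn_sorted.
move=> i j ij /=; rewrite ltnS leq_double; apply: sub_count => x /=.
exact: ltn_trans.
Qed.

Lemma odd_of_ok k m D : 0 < m -> k <= m -> sorted gtn D -> all (between m) D ->
  odd_parts_ok k (odd_of m D).
Proof.
move=> m0 km sD Dm; split.
- exact: odd_of_sorted.
- by apply/allP => x /mapP[i _ ->] /=; rewrite odd_double.
- by rewrite size_mkseq.
move=> i oi im.
have imax : i < (size D).*2.+1.
  apply: leq_trans im _; apply/bigmax_leqP_seq => x /mapP[j _ ->] _.
  by rewrite ltnS leq_double count_size.
have iE : i = i./2.*2.+1 by rewrite -[LHS]odd_double_half oi.
have iD : i./2 < size D by lia.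
have := mem_nth 0 iD => /(allP Dm)/andP[_ dm].
(* Write i = 2c + 1. At the position given by the entry of index c in the decreasing list [D],
   exactly c elements of [D] are larger, so the part there is i. *)
apply/mapP; exists (nth 0 D i./2); first by rewrite mem_iota.
by rewrite count_gtn_nth.
Qed.

Lemma count_gtn_iota m d : d <= m -> count (gtn d) (iota 0 m) = d.
Proof.
move=> dm; rewrite -(subnKC dm) iotaD count_cat add0n.
have /all_filterP/(congr1 size) : all (gtn d) (iota 0 d).
  by apply/allP => i; rewrite mem_iota => /andP[].
rewrite size_filter size_iota => ->; apply/eqP; rewrite -[eqbRHS]addn0 eqn_add2l.
rewrite -leqn0 leqNgt -has_count; apply/hasPn => i.
by rewrite mem_iota => /andP[di _]; rewrite /= -leqNgt.
Qed.

(** Double counting: each d in [D] adds 2 to the parts at positions 0, ..., d - 1, all of which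
    exist because d < m. *)
Lemma sumn_odd_of m D : all (between m) D -> sumn (odd_of m D) = m + (sumn D).*2.
Proof.
move=> Dm; rewrite /odd_of /mkseq sumnE big_map.
under eq_bigr do rewrite -addn1 addnC.
rewrite big_split /= sum1_size size_iota; congr (_ + _).
under eq_bigr do rewrite -mul2n.
rewrite -big_distrr /= mul2n; congr double.
elim: D Dm => [|d D IH] /=; first by rewrite big1.
move=> /andP[/andP[_ dm] /IH {}IH].
rewrite big_split /= IH; congr (_ + _).
by rewrite -[RHS](count_gtn_iota (ltnW dm)) -sumn_count sumnE big_map.
Qed.

Lemma descents_between o : all (between (size o)) (descents o).
Proof.
apply/allP => x; rewrite mem_filter mem_rev mem_iota /between => /andP[_].
by case: (size o) => [|m]; lia.
Qed.

Lemma descents_sorted o : sorted gtn (descents o).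
Proof. exact/sorted_gtn_filter/sorted_gtn_rev_iota. Qed.

Lemma count_ltn_pred d D : 0 < d ->
  count (ltn d.-1) D = count_mem d D + count (ltn d) D.
Proof.
move=> d0; elim: D => //= x D ->; rewrite prednK// leq_eqVlt eq_sym.
by case: eqVneq => [->|_] /=; lia.
Qed.

Lemma odd_ofK m D : sorted gtn D -> all (between m) D ->
  descents (odd_of m D) = D.
Proof.
move=> sD Dm; apply: eq_sorted_gtn => //; first exact: descents_sorted.
move=> d; rewrite mem_filter mem_rev mem_iota size_mkseq.
have [dm|dm] := boolP (between m d); last first.
  have /negPf-> : d \notin D by apply: contra dm => /(allP Dm).
  apply/negbTE; rewrite negb_and; apply/orP; right.
  by move: dm; rewrite /between; lia.
case/andP: dm => d0 dm; rewrite !nth_mkseq ?count_ltn_pred//; last by lia.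
rewrite count_uniq_mem ?sorted_gtn_uniq//.
have -> : d < 1 + m.-1 by lia.
rewrite d0 !andbT; case: (d \in D); last by rewrite add0n eqxx.
by apply/eqP; lia.
Qed.

(** Consecutive parts differ by 0 or 2: a larger drop would skip an odd value below the largest
    part. *)
Lemma nth_odd_parts k o i : odd_parts_ok k o -> i.+1 < size o ->
  nth 0 o i = nth 0 o i.+1 + (nth 0 o i != nth 0 o i.+1).*2.
Proof.
move=> [so oo _ gap] io; have io' := ltnW io.
have le_nth a b : a <= b -> b < size o -> nth 0 o b <= nth 0 o a.
  move=> ab bo; apply: (sorted_leq_nth geq_trans leqnn 0 so) => //=.
  exact: leq_ltn_trans ab bo.
have [/=->|ne] := eqVneq; first by rewrite addn0.
have o1 := allP oo _ (mem_nth 0 io'); have o2 := allP oo _ (mem_nth 0 io).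
have le := le_nth _ _ (leqnSn i) io.
suff : ~~ ((nth 0 o i.+1).+2 < nth 0 o i).
  move: (nth 0 o i) (nth 0 o i.+1) o1 o2 le ne => x y ox oy le ne nlt.
  have [xE|->] : x = y.+1 \/ x = y.+2 by lia.
    by move: ox; rewrite xE /= oy.
  by rewrite addn2.
apply/negP => lt.
have : (nth 0 o i.+1).+2 \in o.
  apply: gap; first by rewrite /= negbK.
  apply: leq_trans lt _; apply: (@leq_bigmax_seq _ _ xpredT id) => //.
  exact: mem_nth.
move=> /(nthP 0)[j jo jE].
case: (leqP j i) => ij.
  by have := le_nth _ _ ij io'; rewrite jE leqNgt lt.
by have := le_nth _ _ ij jo; rewrite jE; lia.
Qed.

(** If the smallest part exceeded 1, then 1 would be a missing odd value. *)
Lemma last_odd_parts k o : odd_parts_ok k o -> 0 < size o ->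
  nth 0 o (size o).-1 = 1.
Proof.
move=> [so oo _ gap] o0.
have lo : nth 0 o (size o).-1 \in o by apply: mem_nth; rewrite prednK.
have := allP oo _ lo => ol.
have [gt|] := ltnP 1 (nth 0 o (size o).-1); last by case: nth ol => [|[]].
have : 1 \in o.
  by apply: gap => //; apply: leq_trans gt _; apply: (@leq_bigmax_seq _ _ xpredT id).
move=> /(nthP 0)[j jo jE].
have : nth 0 o (size o).-1 <= nth 0 o j.
  apply: (sorted_leq_nth geq_trans leqnn 0 so) => //=.
    by rewrite inE prednK.
  by rewrite -ltnS prednK.
by rewrite jE => /(leq_trans gt).
Qed.

Lemma descentsK k o : odd_parts_ok k o -> odd_of (size o) (descents o) = o.
Proof.
move=> oo; apply: (@eq_from_nth _ 0); rewrite size_mkseq// => i io.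
rewrite nth_mkseq//.
have : i <= (size o).-1 by lia.
(* Induction on the distance t from the last position: the last part is 1, and each step backward
   adds 2 exactly at a descent. *)
move=> /subKn <-; set t := _ - i.
have : t < size o by rewrite /t; lia.
elim: t => [|t IH] to.
  rewrite subn0 (last_odd_parts oo)//.
  suff -> : count (ltn (size o).-1) (descents o) = 0 by [].
  apply/eqP; rewrite -leqn0 leqNgt -has_count; apply/hasPn => x.
  by move=> /(allP (descents_between o)) /andP[_]; rewrite /ltn /=; lia.
have jE : ((size o).-1 - t.+1).+1 = (size o).-1 - t by lia.
rewrite (nth_odd_parts oo) jE; last by lia.
rewrite -[X in _ = X + _](IH (ltnW to)).
rewrite (_ : (size o).-1 - t.+1 = ((size o).-1 - t).-1); last by lia.
rewrite count_ltn_pred; last by lia.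
rewrite count_uniq_mem ?(sorted_gtn_uniq (descents_sorted o))//.
rewrite mem_filter mem_rev mem_iota.
have -> : 0 < (size o).-1 - t < 1 + (size o).-1 by lia.
by rewrite andbT addSn -doubleD addnC.
Qed.

(** * Even parts and their marks *)

Lemma rev_undup_sorted h : sorted geq h -> sorted ltn (rev (undup h)).
Proof.
move=> sh; rewrite rev_sorted gtn_sorted_uniq_geq undup_uniq /=.
by apply: subseq_sorted sh; [exact: geq_trans | exact: undup_subseq].
Qed.

Lemma count_leq_nth (v : seq nat) i : sorted ltn v -> i < size v ->
  count (fun x => x <= nth 0 v i) v = i.+1.
Proof. exact: Order.PreorderTheory.count_le_nth. Qed.

Lemma count_ltn_nth (v : seq nat) i : sorted ltn v -> i < size v ->
  count (fun x => x < nth 0 v i) v = i.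
Proof. exact: Order.PreorderTheory.count_lt_nth. Qed.

Lemma even_of_ok k m h : sorted geq h -> all (between m) h ->
  size (undup h) = k.-1 -> even_parts_ok k m (even_of h).
Proof.
move=> sh hm hk; have sv := rev_undup_sorted sh.
set v := rev (undup h) in sv.
have vk : size v = k.-1 by rewrite size_rev.
have mem_v x : (x \in v) = (x \in h) by rewrite mem_rev mem_undup.
have countE p : count (fun x => x <= p) (undup h) = count (fun x => x <= p) v.
  by rewrite count_rev.
have v_between x : x \in v -> between m x by rewrite mem_v => /(allP hm).
split.
- rewrite -map_comp; apply: (homo_sorted (e := geq)) sh => x y /=.
  by rewrite leq_double.
- by apply/allP => x /mapP[p /(allP hm)/andP[_ pm] ->] /=; rewrite ltn_double.
(* M_j is the j-th smallest distinct value of [h]; marks start at 1 and list positions at 0. *)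
exists (fun j => nth 0 v j.-1); split.
- move=> j /andP[j1 jk]; have : j.-1 < size v by rewrite vk; lia.
  by move=> /(mem_nth 0)/v_between/andP[].
- move=> i j i1 ij jk; apply: (sorted_ltn_nth ltn_trans) => //=;
    rewrite ?inE ?vk; lia.
- move=> x /mapP[p ph ->]; rewrite /mark /part /=.
  have /(nthP 0)[i iv <-] : p \in v by rewrite mem_v.
  by rewrite countE count_leq_nth// -vk iv.
- move=> j /andP[j1 jk]; have jv : j.-1 < size v by rewrite vk; lia.
  apply/mapP; exists (nth 0 v j.-1); first by rewrite -mem_v mem_nth.
  by rewrite countE count_leq_nth// prednK.
Qed.

Lemma even_ofK h : halves (even_of h) = h.
Proof.
rewrite /halves -map_comp -[RHS]map_id; apply: eq_map => x /=.
by rewrite /part /= doubleK.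
Qed.

Lemma sumn_even_of h : sumn (map part (even_of h)) = (sumn h).*2.
Proof. by rewrite -map_comp; elim: h => //= x h ->; rewrite doubleD. Qed.

(** As M is increasing, the distinct halves are exactly M_1 < ... < M_(k-1), and the number of them
    that are at most M_j is j; so the mark is recovered as a rank. *)
Lemma halves_ok k m e : even_parts_ok k m e ->
  [/\ sorted geq (halves e), all (between m) (halves e),
     size (undup (halves e)) = k.-1 & even_of (halves e) = e].
Proof.
move=> [se em [M [M0 Mlt eM Me]]].
have halfE x : x \in e -> (part x)./2 = M (mark x).
  by move=> /eM[_ ->]; rewrite doubleK.
have M_inj : {in iota 1 k.-1 &, injective M}.
  move=> i j; rewrite !mem_iota => ik jk Mij.
  have [ij|ij|//] := ltngtP i j.
    by have := Mlt i j; lia.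
  by have := Mlt j i; lia.
have pE : perm_eq (undup (halves e)) (map M (iota 1 k.-1)).
  apply: uniq_perm; rewrite ?undup_uniq// ?map_inj_in_uniq ?iota_uniq//.
  move=> y; rewrite mem_undup; apply/mapP/mapP => [[x xe ->]|[j jk ->]].
    exists (mark x); last exact: halfE.
    by rewrite mem_iota; have [] := eM _ xe; lia.
  rewrite mem_iota in jk.
  by exists ((M j).*2, j); [apply: Me; lia | rewrite /part /= doubleK].
split.
- rewrite /halves (map_comp half part).
  by apply: (homo_sorted (e := geq)) se => x y /=; exact: half_leq.
- apply/allP => _ /mapP[x xe ->]; rewrite halfE//; have [xk xM] := eM _ xe.
  by have := allP em _ xe; rewrite /between M0//= xM ltn_double.
- by rewrite (perm_size pE) size_map size_iota.
rewrite /even_of -map_comp -[RHS]map_id; apply/eq_in_map => x xe /=.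
have [/andP[x1 xk] xM] := eM _ xe.
rewrite (permP pE) count_map halfE// -xM [RHS]surjective_pairing.
congr (_, _).
have -> : count (preim M (fun v => v <= M (mark x))) (iota 1 k.-1) =
    count (gtn (mark x).+1) (iota 1 k.-1).
  apply: eq_in_count => j; rewrite mem_iota => jk /=.
  rewrite ltnS; have [jx|xj|->] := ltngtP j (mark x); last by rewrite leqnn.
    by rewrite ltnW// Mlt//; lia.
  by apply/negbTE; rewrite -ltnNge Mlt//; lia.
(* The interval is extended down to 0; the entry 0 accounts for the extra 1 on each side. *)
have := @count_gtn_iota k.-1.+1 (mark x).+1.
by rewrite ltnS xk => /(_ isT) /=; rewrite add1n => -[].
Qed.

(** Supplies the bound of at least k odd parts: k - 1 distinct values fit in [1, m - 1]. A member of
    [h] gives m > 0, so [m.-1] is a true subtraction. *)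
Lemma half_parts_lt k m h : 0 < k -> size (undup h) = k.-1 ->
  all (between m) h -> 0 < size h -> k <= m.
Proof.
move=> k0 hk hm h0.
have : size (undup h) <= m.-1.
  apply: size_between; first exact: undup_uniq.
  by apply/allP => x; rewrite mem_undup => /(allP hm).
have : 0 < m by case: h h0 hm {hk} => //= x h _ /andP[/andP[_]]; lia.
lia.
Qed.

(** * The bijection between triples and marked partitions *)

Definition to_partition (u : triple) : seq nat * seq mpart :=
  let: (m, D, h) := u in (odd_of m D, even_of h).

Definition of_partition (u : seq nat * seq mpart) : triple :=
  (size u.1, descents u.1, halves u.2).

Lemma to_partition_ok k n u : 1 < k -> is_triple k n u ->
  [/\ marked_partition k n (to_partition u), of_partition (to_partition u) = u &
     size (to_partition u).2 = size u.2].
Proof.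
case: u => [[m D] h] k1 /and4P[/andP[sD sh] /andP[Dm hm] /eqP hk /eqP sz].
have h0 : 0 < size h by case: h hk {sh hm sz} => //=; lia.
have km : k <= m by apply: half_parts_lt hk hm h0; lia.
split.
- split; rewrite /= ?size_mkseq.
  + by apply: odd_of_ok => //; lia.
  + exact: even_of_ok.
  + by rewrite sumn_odd_of// sumn_even_of -addnA -doubleD.
- by rewrite /of_partition /= size_mkseq odd_ofK// even_ofK.
- by rewrite size_map.
Qed.

Lemma of_partition_ok k n u : 0 < k -> marked_partition k n u ->
  is_triple k n (of_partition u) /\ to_partition (of_partition u) = u.
Proof.
case: u => o e k0 [/= oo ee sz]; have [sh hm hk eK] := halves_ok ee.
have oK := descentsK oo.
split; last by rewrite /= oK eK.
rewrite /is_triple /= descents_sorted descents_between sh hm hk eqxx /=.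
have := sumn_odd_of (descents_between o); rewrite oK => so.
have := sumn_even_of (halves e); rewrite eK => se.
by rewrite -sz so se -addnA -doubleD.
Qed.

(** * Fixed triples and self-conjugate symbols *)

Definition row_of (D h : seq nat) : seq mpart :=
  [seq (p, (count (fun a => a < p) h).+1) | p <- sort geq (D ++ h)].

Definition symbol_of (u : triple) : msymbol :=
  let: (m, D, h) := u in MSymbol m (row_of D h) (row_of D h).

Definition max_with_mark (r : seq mpart) (j : nat) : nat :=
  \max_(x <- r | mark x == j) part x.

Definition maxima (k : nat) (r : seq mpart) : seq nat :=
  rev [seq max_with_mark r j | j <- iota 1 k.-1].

Definition triple_of (k : nat) (s : msymbol) : triple :=
  let h := maxima k (top_row s) in
  (peak s, [seq p <- map part (top_row s) | p \notin h], h).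

(** The conditions on the common row of a self-conjugate symbol with peak [m]; [good_rowE] proves
    the equivalence. *)
Record good_row (k m : nat) (r : seq mpart) : Prop := GoodRow {
  good_parts : sorted gtn (map part r);
  good_between : all (between m) (map part r);
  good_mark_le : all (fun x => 1 <= mark x <= k) r;
  good_marks : sorted geq (map mark r);
  good_surj : forall j, 1 <= j <= k.-1 -> j \in map mark r
}.

Lemma strongly_unimodal_symm p (a : seq nat) :
  strongly_unimodal (rev a ++ p :: a) (size a) =
  [&& 0 < p, all (between p) a & sorted gtn a].
Proof.
rewrite /strongly_unimodal size_cat size_rev /= addnS ltnS leq_addr /=.
rewrite take_cat drop_cat size_rev !ltnn subnn drop0 ltnNge leqnSn /=.
rewrite subSnn /= take0 cats1 -rev_cons rev_sorted all_cat all_rev /=.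
rewrite path_sortedE; last exact: gtn_trans.
have -> : all (between p) a = all (ltn 0) a && all (gtn p) a.
  by rewrite -all_predI; apply: eq_all.
by case: (all (ltn 0) a); case: (all (gtn p) a); case: (0 < p);
  rewrite /= ?andbF ?andbT ?andbb.
Qed.

Lemma mark_monotone k m r x y : good_row k m r -> x \in r -> y \in r ->
  part x <= part y -> mark x <= mark y.
Proof.
move=> [sp _ _ sm _] /(nthP x)[i ir <-] /(nthP x)[j jr <-] pxy.
have [ji|ij] := leqP j i.
  have := sorted_leq_nth geq_trans leqnn 0 sm j i.
  by rewrite !inE size_map !(nth_map x)//; apply.
have := sorted_ltn_nth gtn_trans 0 sp i j.
rewrite !inE size_map !(nth_map x)// => /(_ ir jr ij) /=.
by rewrite ltnNge pxy.
Qed.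

Lemma part_lt k m r x y : good_row k m r -> x \in r -> y \in r ->
  mark x < mark y -> part x < part y.
Proof.
move=> gr xr yr mxy; rewrite ltnNge; apply/negP => /(mark_monotone gr yr xr).
by rewrite leqNgt mxy.
Qed.

Lemma bigmax_attained (T : eqType) (f : T -> nat) (s : seq T) :
  0 < size s -> exists2 x, x \in s & f x = \max_(i <- s) f i.
Proof.
elim: s => // y s IH _; rewrite big_cons.
have [s0|/IH[x xs xE]] := posnP (size s).
  by exists y; rewrite ?mem_head// (size0nil s0) big_nil maxn0.
have [xy|yx] := leqP (\max_(i <- s) f i) (f y).
  by exists y; rewrite ?mem_head.
by exists x; rewrite // in_cons xs orbT.
Qed.

(** Each mark from 1 to k - 1 occurs, so the maximum is a genuine part and not the default 0 of an
    empty maximum. *)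
Lemma max_with_markP k m r j : good_row k m r -> 1 <= j <= k.-1 ->
  exists2 x, x \in r & mark x = j /\ part x = max_with_mark r j.
Proof.
move=> gr /(good_surj gr) /mapP[y yr yj]; rewrite /max_with_mark -big_filter.
have [|x] := @bigmax_attained _ part [seq x <- r | mark x == j].
  by rewrite size_filter -has_count; apply/hasP; exists y; rewrite // yj.
by rewrite mem_filter => /andP[/eqP xj xr] xE; exists x.
Qed.

Lemma le_max_with_mark r x : x \in r -> part x <= max_with_mark r (mark x).
Proof.
move=> xr; apply: (@leq_bigmax_seq _ r (fun y => mark y == mark x) part) => //.
Qed.

(** With equal rows the interval conditions follow from monotonicity of the marks: a part marked j <
    k is at most M_j by maximality, and it exceeds every part of smaller mark, hence M_(j-1). For
    mark k the upper bound comes from the peak. *)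
Lemma good_rowE k n m r : 1 < k ->
  SCU_set k n (MSymbol m r r) <->
  good_row k m r /\ m + (sumn (map part r)).*2 = n.
Proof.
move=> k1.
have szE : msymbol_size (MSymbol m r r) = m + (sumn (map part r)).*2.
  by rewrite /msymbol_size /= -addnA addnn.
rewrite /SCU_set /= szE; split.
  move=> [[/= su [/and3P[a b c] _] d _ _] _ ->]; split=> //.
  move: su; rewrite -(size_map part) strongly_unimodal_symm => /and3P[m0 am sm].
  by split.
move=> [gr szn]; have [a b c d e] := gr; split=> //.
have mr : marked_row k r by apply/and3P; split.
have lower x : x \in r -> Mbound k (MSymbol m r r) (mark x).-1 < part x.
  move=> xr; have /andP[x1 xk] := allP c _ xr.
  rewrite /Mbound; case: ifPn => [_|xn].
    by have := allP b _ (map_f part xr); case/andP.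
  rewrite ifN; last by apply/eqP; lia.
  rewrite /=.
  have px0 : 0 < part x by have := allP b _ (map_f part xr); case/andP.
  rewrite -(prednK px0) ltnS; apply/bigmax_leqP_seq => y yr /eqP yx.
  by rewrite -ltnS prednK//; apply: (part_lt gr) => //; rewrite yx; lia.
split=> //=.
- rewrite -(size_map part) strongly_unimodal_symm b a !andbT.
  (* The peak is positive because it exceeds some part; one marked 1 exists since k >= 2. *)
  have [|x xr _] := (fun p => mapP (e 1 p)); first by lia.
  have /andP[_ xm] := allP b _ (map_f part xr).
  exact: leq_ltn_trans (leq0n _) xm.
- move=> x xr xk; rewrite lower//=; rewrite /Mbound.
  have /andP[x1 _] := allP c _ xr.
  by rewrite !ifN ?le_max_with_mark//; apply/eqP; lia.
- move=> x xr xk; have := lower _ xr; rewrite xk => -> /=.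
  rewrite /Mbound eqxx ifN; last by apply/eqP; lia.
  have /andP[_ xm] := allP b _ (map_f part xr).
  by rewrite -ltnS prednK//; exact: leq_ltn_trans (leq0n _) xm.
Qed.

Lemma is_fixedE m D h : sorted gtn D -> is_fixed (m, D, h) = uniq (D ++ h).
Proof.
move=> sD; rewrite cat_uniq (sorted_gtn_uniq sD) /= -all_predC.
apply/allP/andP => [nf|[/hasPn nD uh] x xh]; last first.
  by rewrite /movable /= xh (negPf (nD _ xh)) count_uniq_mem// xh.
split.
  by apply/hasPn => x xh; have := nf x xh; rewrite /movable /= xh negb_or => /andP[].
apply: count_mem_uniq => x; have [xh|xh] := boolP (x \in h); last first.
  exact/count_memPn.
have := nf x xh; rewrite /movable /= xh negb_or -leqNgt => /andP[_ c1].
by apply/eqP; rewrite eqn_leq c1 -has_count has_pred1.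
Qed.

Lemma map_part_row_of D h : map part (row_of D h) = sort geq (D ++ h).
Proof. by rewrite -map_comp -[RHS]map_id; apply: eq_map. Qed.

Lemma sort_gtn s : uniq s -> sorted gtn (sort geq s).
Proof.
move=> us; rewrite gtn_sorted_uniq_geq sort_uniq us.
exact: sort_sorted geq_total _.
Qed.

Lemma row_of_good k m D h : 0 < k -> uniq (D ++ h) -> sorted geq h ->
  all (between m) (D ++ h) -> size h = k.-1 -> good_row k m (row_of D h).
Proof.
move=> k0 uDh sh Dhm hk; split.
- by rewrite map_part_row_of; exact: sort_gtn.
- by rewrite map_part_row_of all_sort.
- apply/allP => _ /mapP[p _ ->]; rewrite /mark /=.
  by rewrite -(prednK k0) ltnS -hk count_size.
- rewrite -map_comp; apply: (homo_sorted (e := gtn)); last exact: sort_gtn.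
  move=> x y yx; rewrite /mark /geq /= ltnS; apply: sub_count => a /= ay.
  exact: ltn_trans ay yx.
move=> j /andP[j1 jk].
have sv : sorted ltn (rev h).
  rewrite rev_sorted gtn_sorted_uniq_geq sh andbT.
  by move: uDh; rewrite cat_uniq => /and3P[].
have jv : j.-1 < size (rev h) by rewrite size_rev hk; lia.
(* The j-th smallest element of [h] has j - 1 elements of [h] below it, so it receives mark j. *)
set p := nth 0 (rev h) j.-1.
have ph : p \in h by rewrite -mem_rev mem_nth.
apply/mapP; exists (p, j) => //; apply/mapP; exists p.
  by rewrite mem_sort mem_cat ph orbT.
by rewrite -count_rev count_ltn_nth// prednK.
Qed.

(** The parts marked j are those above the (j-1)-st smallest element of [h] and at most the j-th,
    which is itself a part and so their maximum. *)
Lemma maxima_row_of k D h : 0 < k -> uniq (D ++ h) -> sorted geq h ->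
  size h = k.-1 -> maxima k (row_of D h) = h.
Proof.
move=> k0 uDh sh hk.
have sv : sorted ltn (rev h).
  rewrite rev_sorted gtn_sorted_uniq_geq sh andbT.
  by move: uDh; rewrite cat_uniq => /and3P[].
rewrite /maxima -[RHS]revK; congr rev.
apply: (@eq_from_nth _ 0); rewrite size_map size_iota ?size_rev// => i ik.
rewrite (nth_map 0) ?size_iota// nth_iota// add1n.
have iv : i < size (rev h) by rewrite size_rev hk.
set p := nth 0 (rev h) i.
have ph : p \in h by rewrite -mem_rev mem_nth.
have cp : count (fun a => a < p) h = i by rewrite -count_rev count_ltn_nth.
have pr : (p, i.+1) \in row_of D h.
  by apply/mapP; exists p; rewrite ?cp// mem_sort mem_cat ph orbT.
apply/eqP; rewrite eqn_leq; apply/andP; split; last exact: le_max_with_mark pr.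
apply/bigmax_leqP_seq => _ /mapP[q _ ->]; rewrite /mark /part /= => /eqP[cq].
rewrite leqNgt; apply/negP => pq.
suff : i < count (fun a => a < q) h by rewrite cq ltnn.
rewrite -[i.+1](count_leq_nth sv iv) count_rev; apply: sub_count => a /=.
by move=> ap; exact: leq_ltn_trans pq.
Qed.

Lemma sumn_cat_sort D h : sumn (sort geq (D ++ h)) = sumn D + sumn h.
Proof. by rewrite sumn_sort sumn_cat. Qed.

Lemma symbol_of_ok k n u : 1 < k -> is_triple k n u -> is_fixed u ->
  SCU_set k n (symbol_of u) /\ triple_of k (symbol_of u) = u.
Proof.
case: u => [[m D] h] k1 /and4P[/andP[sD sh] Dhm /eqP hk /eqP sz].
rewrite is_fixedE// -all_cat in Dhm * => uDh.
have uh : uniq h by move: uDh; rewrite cat_uniq => /and3P[].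
rewrite (undup_id uh) in hk; have k0 := ltnW k1.
split.
  apply/(good_rowE _ _ _ k1); split; first exact: row_of_good.
  by rewrite map_part_row_of sumn_cat_sort.
rewrite /triple_of /= maxima_row_of// map_part_row_of; congr (_, _, _).
apply: eq_sorted_gtn => //; first exact/sorted_gtn_filter/sort_gtn.
move=> x; rewrite mem_filter mem_sort mem_cat.
have [xh|xh] := boolP (x \in h); last by rewrite orbF.
move: uDh; rewrite cat_uniq => /and3P[_ /hasPn/(_ _ xh) /= xD _].
by rewrite (negPf xD).
Qed.

Lemma sorted_maxima k m r : good_row k m r -> sorted gtn (maxima k r).
Proof.
move=> gr; rewrite rev_sorted.
apply: (homo_sorted_in (P := [pred i | 1 <= i <= k.-1]) (e := ltn));
  last exact: iota_ltn_sorted; last first.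
  by apply/allP => x; rewrite mem_iota /=; lia.
move=> i j; rewrite !inE => ik jk ij.
have [x xr [xi <-]] : exists2 x, x \in r & mark x = i /\ part x = max_with_mark r i.
  by apply: (max_with_markP gr); lia.
have [y yr [yj <-]] : exists2 x, x \in r & mark x = j /\ part x = max_with_mark r j.
  by apply: (max_with_markP gr); lia.
by apply: (part_lt gr) => //; rewrite xi yj.
Qed.

Lemma triple_of_ok k n s : 1 < k -> SCU_set k n s ->
  [/\ is_triple k n (triple_of k s), is_fixed (triple_of k s) &
     symbol_of (triple_of k s) = s].
Proof.
case: s => m r r' k1 Ss; have /= rr' : r = r' by case: Ss.
rewrite -rr' in Ss *; move: Ss {rr'} => /(good_rowE _ _ _ k1)[gr sz].
have [sp pm mk sm _] := gr.
rewrite /triple_of /=; set h := maxima k r; set D := filter _ _.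
have sh : sorted gtn h by exact: sorted_maxima gr.
have hr p : p \in h -> p \in map part r.
  rewrite mem_rev => /mapP[j]; rewrite mem_iota => jk ->.
  have [|x xr [_ <-]] := max_with_markP gr (j := j); first by lia.
  exact: map_f.
have sD : sorted gtn D by exact: sorted_gtn_filter.
have uDh : uniq (D ++ h).
  rewrite cat_uniq !sorted_gtn_uniq//= andbT.
  by apply/hasPn => x xh; rewrite mem_filter /= xh.
have DhE : sort geq (D ++ h) = map part r.
  apply: eq_sorted_gtn => //; first exact: sort_gtn.
  move=> p; rewrite mem_sort mem_cat mem_filter.
  by case: (boolP (p \in h)) => /= [/hr->|]; rewrite ?orbT ?orbF.
have rE : row_of D h = r.
  rewrite /row_of DhE -map_comp -[RHS]map_id; apply/eq_in_map => x xr /=.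
  rewrite [RHS]surjective_pairing; congr (_, _).
  have /andP[x1 xk] := allP mk _ xr.
  rewrite count_rev count_map.
  (* M_j is below a part exactly when j is less than its mark, so the given marks agree with those
     assigned by [row_of]. *)
  have -> : count (preim (max_with_mark r) (fun a => a < part x)) (iota 1 k.-1) =
      count (gtn (mark x)) (iota 1 k.-1).
    apply: eq_in_count => j; rewrite mem_iota => jk /=.
    have [|y yr [yj yE]] := max_with_markP gr (j := j); first by lia.
    rewrite -yE -yj; apply/idP/idP; last exact: (part_lt gr).
    apply: contraTT; rewrite -!leqNgt leq_eqVlt => /orP[/eqP xy|].
      by rewrite yE -yj -xy le_max_with_mark.
    by move=> xy; rewrite ltnW// (part_lt gr).
  have := @count_gtn_iota k.-1.+1 (mark x).
  by rewrite {1}(prednK (ltnW k1)) => /(_ xk) /=; rewrite x1 add1n.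
split=> //; last by rewrite rE.
- rewrite /is_triple sD -all_cat -(all_sort _ geq) DhE pm.
  have -> : sorted geq h by move: sh; rewrite gtn_sorted_uniq_geq => /andP[].
  rewrite (undup_id (sorted_gtn_uniq sh)).
  by rewrite size_rev size_map size_iota eqxx -sumn_cat_sort DhE sz eqxx.
- by rewrite -/(is_fixed (m, D, h)) is_fixedE.
Qed.

(** * Transfer of the three counts to triples, and cancellation *)

Section Parity.
Local Open Scope classical_set_scope.
Variables (k n : nat) (k1 : 1 < k).

Let A : set triple := [set u | is_triple k n u].
Let F : set triple := [set u | is_fixed u].

Lemma finite_triples : finite_set A.
Proof.
apply: (finite_set_bij (finite_marked_partition k n)
  (f := of_partition) (g := to_partition)).
- by move=> u /(of_partition_ok (ltnW k1))[].
- by move=> u /(to_partition_ok k1)[].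
- by move=> u /(to_partition_ok k1)[].
Qed.

Lemma number_of_parity b :
  number_of (marked_partition k n `&` [set u | odd (size u.2) = b]) =
  number_of (A `&` [set u | odd (size u.2) = b]).
Proof.
have fP := finite_marked_partition k n.
apply: (number_of_bij (f := of_partition) (g := to_partition)).
- exact: finite_setIl.
- by move=> u [/(of_partition_ok (ltnW k1))[Au _] /= ub]; rewrite size_map.
- by move=> u [/(to_partition_ok k1)[Pu _ su] /= ub]; split; rewrite //= su.
- by move=> u [/(of_partition_ok (ltnW k1))[_ uK] _].
- by move=> u [/(to_partition_ok k1)[_ uK _] _].
Qed.

Lemma omegaE : omega k n = number_of (A `&` [set u | odd (size u.2) = true]).
Proof. by rewrite -number_of_parity. Qed.

Lemma epsilonE : epsilon k n = number_of (A `&` [set u | odd (size u.2) = false]).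
Proof.
rewrite -number_of_parity; congr number_of; congr (_ `&` _).
by apply/seteqP; split=> u /=; [move/negbTE | move=> ->].
Qed.

Lemma scuE : scu k n = number_of (A `&` F).
Proof.
apply: (number_of_bij (f := triple_of k) (g := symbol_of)).
- exact: finite_SCU_set.
- by move=> s /(triple_of_ok k1)[].
- by move=> u [Au Fu]; have [] := symbol_of_ok k1 Au Fu.
- by move=> s /(triple_of_ok k1)[].
- by move=> u [Au Fu]; have [] := symbol_of_ok k1 Au Fu.
Qed.

Lemma size_fixed u : A u -> F u -> size u.2 = k.-1.
Proof.
case: u => [[m D] h] /and4P[/andP[sD sh] _ /eqP hk _].
rewrite /F /= -/(is_fixed (m, D, h)) is_fixedE// cat_uniq => /and3P[_ _ uh].
by rewrite -hk undup_id.
Qed.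

(** Fixed triples have #h = k - 1, so they all lie in the parity class of k - 1; [toggle] cancels
    the remaining triples of that class against the other class. *)
Lemma parity_cancel b : odd k.-1 = b ->
  number_of (A `&` [set u | odd (size u.2) = b]) =
  scu k n + number_of (A `&` [set u | odd (size u.2) = ~~ b]).
Proof.
move=> kb; rewrite scuE.
apply: (number_of_involution (w := fun u : triple => size u.2) (t := toggle)).
- exact: finite_triples.
- by move=> u Au Fu; rewrite size_fixed.
by move=> u Au /negP Fu; have [? /negP ? ? ?] := toggle_triple Au Fu.
Qed.

End Parity.

Local Open Scope ring_scope.
Unset Implicit Arguments.

Theorem theorem1p6 (k : nat) (hk : (2 <= k)%N) :
  SCU k = Fps (fun n : nat =>
    (-1) ^+ k * (Posz (omega k n) - Posz (epsilon k n))).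
Proof.
congr Fps; apply/funext => n.
have := parity_cancel n hk erefl; rewrite omegaE// epsilonE//.
have -> : odd k.-1 = ~~ odd k by rewrite -{2}(prednK (ltnW hk)) /= negbK.
(* For k even the cancellation reads omega = scu + epsilon, for k odd epsilon = scu + omega. *)
rewrite -GRing.signr_odd; case: (odd k) => /= ->; lia.
Qed.
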